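(* Let $p$ be a positive integer and $m,k$ integers. Let $i\in\{0,\dots,p-1\}$ be the remainder of $-m+k-2$ divided by $p$, and put $m'=m-2p+1$ and $k'=k+p-2$. Then $$z^{-m/p}q^{m^2/2p}\sum_{r\ge0}q^{pr^2/2+mr}\begin{bmatrix}k-m+p-2+(1-p)r\\ r\end{bmatrix}_q z^{-r}$$ $$=z^{(-k'+i)/p}q^{(k'^2+i^2-2k'i)/2p}\sum_{r\ge0}q^{pr^2/2+(i-k')r}\begin{bmatrix}\frac{-m'+k'-i+1}{p}-2+i+(p-1)r\\ i+pr\end{bmatrix}_q z^{r}.$$
   Context: Here $z,q$ are formal variables (fractional powers allowed). $\begin{bmatrix}n\\ r\end{bmatrix}_q$ denotes the $q$-binomial coefficient: it equals $\dfrac{(q)_n}{(q)_r(q)_{n-r}}$ if $n\ge r\ge0$ and $0$ otherwise, where $(q)_0=1$ and $(q)_r=(1-q)(1-q^2)\cdots(1-q^r)$. *)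

(* Defs.v *)
From HB Require Import structures.
From mathcomp Require Import all_boot all_order all_algebra.
From mathcomp Require Import finmap monalg.
From mathcomp Require Import boolp classical_sets fsbigop.

Set Implicit Arguments.
Unset Strict Implicit.
Unset Printing Implicit Defensive.

Import Order.TTheory GRing.Theory Num.Theory.

Local Open Scope ring_scope.

(* The exponent monoid: [monomType] has no nontrivial invertible elements, so  *)
(* negative exponents only appear after passing to fractions, in [vpow].       *)
Record nnrat := NNRat { nnrat_val :> rat; _ : 0 <= nnrat_val }.

HB.instance Definition _ := [isSub for nnrat_val].
HB.instance Definition _ := [Choice of nnrat by <:].

Section NNRat.
Implicit Types a b c : nnrat.

Lemma nnrat_ge0 a : 0 <= (a : rat). Proof. exact: valP. Qed.

Definition nnrat0 : nnrat := NNRat (lexx 0).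
Definition nnratD a b : nnrat := NNRat (addr_ge0 (nnrat_ge0 a) (nnrat_ge0 b)).

Fact nnratDA : associative nnratD.
Proof. by move=> a b c; apply: val_inj; rewrite /= addrA. Qed.
Fact nnratDC : commutative nnratD.
Proof. by move=> a b; apply: val_inj; rewrite /= addrC. Qed.
Fact nnrat0D : left_id nnrat0 nnratD.
Proof. by move=> a; apply: val_inj; rewrite /= add0r. Qed.
Fact nnratD0 : right_id nnrat0 nnratD.
Proof. by move=> a; rewrite nnratDC nnrat0D. Qed.
Fact nnratD_eq0 a b : nnratD a b = nnrat0 -> a = nnrat0 /\ b = nnrat0.
Proof.
move=> /(congr1 val)/eqP /=; rewrite paddr_eq0 ?nnrat_ge0//.
by move=> /andP[/eqP a0 /eqP b0]; split; apply: val_inj.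
Qed.

HB.instance Definition _ := Choice_isMonomialDef.Build nnrat
  nnratDA nnrat0D nnratD0 nnratD_eq0.
HB.instance Definition _ := MonomialDef_isConomialDef.Build nnrat nnratDC.
End NNRat.

(* [{malg K[nnrat]}] is the ring of polynomials over [K] in fractional powers  *)
(* of one variable; it is made an integral domain by a leading-term argument.  *)
Section FracPoly.
Variable K : fieldType.
Implicit Types f g h : {malg K[nnrat]}.

Lemma msupp_lead g : g != 0 ->
  exists2 d : nnrat, d \in msupp g &
    forall k : nnrat, k \in msupp g -> (k : rat) <= (d : rat).
Proof.
move=> g0; suff H (s : seq nnrat) : s != [::] -> exists2 d : nnrat, d \in s &
    forall k : nnrat, k \in s -> (k : rat) <= (d : rat).
  by apply: H; apply: contraNneq g0 => s0; rewrite -msupp_eq0 -cardfs_eq0 s0.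
elim: s => // a s IH _.
have [->|/IH[d ds dmax]] := eqVneq s [::].
  by exists a => [|k]; rewrite !inE// => /eqP ->.
case: (leP (d : rat) (a : rat)) => [da|/ltW ad].
  exists a => [|k]; rewrite inE ?eqxx//.
  by case/predU1P => [->//|/dmax /le_trans]; exact.
by exists d => [|k]; rewrite inE ?ds ?orbT// => /predU1P[->//|/dmax].
Qed.

Lemma mcoeffM_lead f g (a b : nnrat) :
    (forall k : nnrat, k \in msupp f -> (k : rat) <= (a : rat)) ->
    (forall k : nnrat, k \in msupp g -> (k : rat) <= (b : rat)) ->
  (f * g)@_(mmul a b) = f@_a * g@_b.
Proof.
move=> fa gb.
rewrite (@mcoeffMlw _ _ (a |` msupp f)%fset (b |` msupp g)%fset) ?fsubsetUr//.
rewrite (big_fsetD1 a) ?fset1U1//= (big_fsetD1 b) ?fset1U1//= eqxx mulr1n.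
rewrite big1_fset ?addr0 => [|k]; last first.
  rewrite !inE => /andP[kb /orP[|_ _]]; first by rewrite (negPf kb).
  case: eqP => // /(congr1 val) /= /addrI/val_inj kbE.
  by rewrite kbE eqxx in kb.
rewrite big1_fset ?addr0 // => k; rewrite !inE => /andP[ka] /orP[kE|kf] _.
  by rewrite kE in ka.
rewrite big1_fset // => l; rewrite !inE => lg _.
case: eqP => // /(congr1 val) /= E; exfalso; move/eqP: ka; apply.
apply: val_inj; apply/eqP; rewrite eq_le fa//=.
have lb : (l : rat) <= b by case/orP: lg => [/eqP->//|/gb].
by rewrite -(lerD2r (b : rat)) -E lerD2l.
Qed.

Fact fracpoly_idomainAxiom f g : f * g = 0 -> (f == 0) || (g == 0).
Proof.
move=> fg0; have [//|/msupp_lead[a af fa]] := eqVneq f 0.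
have [//|/msupp_lead[b bg gb]] := eqVneq g 0.
have := mcoeffM_lead fa gb; rewrite fg0 mcoeff0 => /esym/eqP.
by rewrite mulf_eq0 !mcoeff_eq0 af bg.
Qed.

Definition fracpoly_unit : pred {malg K[nnrat]} :=
  [pred g | (g == (g@_mone)%:MP) && (g@_mone != 0)].
Definition fracpoly_inv g : {malg K[nnrat]} :=
  if fracpoly_unit g then ((g@_mone)^-1)%:MP else g.

Fact fracpoly_mulVp : {in fracpoly_unit, left_inverse 1 fracpoly_inv *%R}.
Proof.
move=> g gu; rewrite /fracpoly_inv (gu : fracpoly_unit g).
case/andP: gu => /eqP gE g0.
by rewrite [X in _ * X]gE -mpolyCM mulVf.
Qed.

Fact fracpoly_intro_unit f g : g * f = 1 -> fracpoly_unit f.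
Proof.
move=> gf1.
have f0 : f != 0 by apply/eqP => f0; move/eqP: gf1; rewrite f0 mulr0 eq_sym oner_eq0.
have g0 : g != 0 by apply/eqP => g0; move/eqP: gf1; rewrite g0 mul0r eq_sym oner_eq0.
have [a ag ga] := msupp_lead g0; have [b bf fb] := msupp_lead f0.
have := mcoeffM_lead ga fb; rewrite gf1 mcoeff1.
case: eqP => [/unitm[_ b1] _|_ /esym/eqP]; last first.
  by rewrite mulf_eq0 !mcoeff_eq0 ag bf.
rewrite /fracpoly_unit /= -b1 mcoeff_neq0 bf andbT.
apply/eqP/malgP => k; rewrite b1 mcoeffC -b1.
have [->|kb] := eqVneq k b; rewrite ?mulr1n// mulr0n.
apply: mcoeff_outdom; apply: contra kb => /fb kb; apply/eqP/val_inj/eqP.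
by rewrite eq_le kb b1 nnrat_ge0.
Qed.

Fact fracpoly_inv_out : {in [predC fracpoly_unit], fracpoly_inv =1 id}.
Proof.
by move=> g gu; rewrite /fracpoly_inv; case: ifP => // gu'; case/negP: gu.
Qed.

HB.instance Definition _ := GRing.ComNzRing_hasMulInverse.Build {malg K[nnrat]}
  fracpoly_mulVp fracpoly_intro_unit fracpoly_inv_out.
HB.instance Definition _ := GRing.ComUnitRing_isIntegral.Build {malg K[nnrat]}
  fracpoly_idomainAxiom.
End FracPoly.

(* Rational functions over [K] in arbitrary rational powers of one variable.   *)
Notation "{ 'fracrat' K }" := {fraction {malg K[nnrat]}}
  (at level 0, K at level 2, format "{ 'fracrat'  K }") : type_scope.

(* [vpow K a] is the [a]-th power of the variable of [{fracrat K}], written    *)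
(* as the quotient of its powers of exponents max(a, 0) and max(-a, 0).        *)
Section VPow.
Variable K : fieldType.

Definition nnpart (a : rat) : nnrat := insubd nnrat0 a.

Definition vpow (a : rat) : {fracrat K} :=
  tofrac (<< nnpart a >> : {malg K[nnrat]})
    / tofrac (<< nnpart (- a) >> : {malg K[nnrat]}).

Lemma tofracU_neq0 (a : nnrat) : tofrac (<< a >> : {malg K[nnrat]}) != 0.
Proof. by rewrite tofrac_eq0 monalgU_eq0 oner_eq0. Qed.

Lemma malgUM (a b : nnrat) :
  << mmul a b >> = << a >> * << b >> :> {malg K[nnrat]}.
Proof. by rewrite malgM_def fgmulUU mulr1. Qed.

Lemma nnpartE (a : rat) : (nnpart a : rat) = Num.max a 0.
Proof.
rewrite /nnpart; case: (leP 0 a) => a0; first by rewrite insubdK.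
by rewrite /insubd insubN// -ltNge.
Qed.

Lemma vpow_nat (n : nat) :
  vpow n%:R = tofrac (<< nnpart 1 >> : {malg K[nnrat]}) ^+ n.
Proof.
have p0 (a : rat) : a <= 0 -> nnpart a = mone.
  by move=> a0; apply: val_inj; rewrite /= nnpartE max_r.
rewrite /vpow [nnpart (- _)]p0 ?oppr_le0// [<< mone >>]/(1 : {malg _[_]}).
rewrite tofrac1 divr1; elim: n => [|n IH]; first by rewrite p0// tofrac1.
rewrite exprS -IH -tofracM -malgUM; congr (tofrac << _ >>); apply: val_inj.
by rewrite /= !nnpartE !max_l// mulrS.
Qed.

Lemma vpow0 : vpow 0 = 1.
Proof. by rewrite /vpow oppr0 divff// tofracU_neq0. Qed.

Lemma vpowD (a b : rat) : vpow (a + b) = vpow a * vpow b.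
Proof.
rewrite /vpow mulrACA -invfM; apply/eqP.
rewrite eqr_div ?mulf_neq0 ?tofracU_neq0//; apply/eqP.
rewrite -!tofracM -!malgUM; congr (tofrac << _ >>); apply: val_inj.
have E c : (nnpart c : rat) = (nnpart (- c) : rat) + c.
  by rewrite !nnpartE; case: (leP 0 c) => c0;
    [rewrite max_r ?oppr_le0// add0r|rewrite max_l ?addNr// oppr_ge0 ltW].
rewrite /= [nnpart (a + b) : rat]E [nnpart a : rat]E [nnpart b : rat]E.
by rewrite -addrA [RHS]addrC [in RHS]addrACA [in RHS](addrC (_ + _) (a + b)).
Qed.
End VPow.

(* The field of the formal variables: rational functions in fractional powers  *)
(* of z whose coefficients are rational functions in fractional powers of q.   *)
Notation Fq := {fracrat rat}.
Notation Fzq := {fracrat Fq}.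

Definition qpow (a : rat) : Fzq := tofrac ((vpow rat a)%:MP : {malg Fq[nnrat]}).
Definition zpow (a : rat) : Fzq := vpow Fq a.

Section QBinomial.
Variables (F : fieldType) (q : F).

Definition qpoch (n : nat) : F := \prod_(1 <= j < n.+1) (1 - q ^+ j).

Definition qbinom (n r : int) : F :=
  if (0 <= r <= n) then qpoch `|n| / (qpoch `|r| * qpoch `|n - r|) else 0.

(* This is what makes the series over r >= 0 finitely supported, so    *)
(* that the notation \sum_(r \in _) of [fsbigop] has its intended meaning.     *)
Lemma qbinom_eq0 (n r : int) : n < r -> qbinom n r = 0.
Proof. by rewrite /qbinom ltNge => /negPf->; rewrite andbF. Qed.
End QBinomial.

(* Main.v *)
Require Import Defs.
From mathcomp Require Import all_boot all_order all_algebra.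
From mathcomp Require Import boolp classical_sets fsbigop.
From mathcomp Require Import zify ring.

Import Order.TTheory GRing.Theory Num.Theory.

Local Open Scope ring_scope.

(** Put [N = k - m + p - 2].  Since [i] is the remainder of [N] modulo [p], there
    is an integer [s] with [N = p * s + i], and the numerical parameters of the
    right-hand side become [k' - i = p * s + m] and
    [(- m' + k' - i + 1) / p - 2 = s].  The Gaussian binomials on both sides then
    vanish unless [0 <= r <= s] (on the left because upper minus lower entry is
    [p * (s - r) + i] with [i < p]), and the two sums agree term by term once one of
    them is read backwards, [r <-> s - r].
    - The binomials: the right one at [s - r] has the same upper entry
      [n = N + (1 - p) * r] as the left one at [r], and lower entry [n - r], so
      they agree by the symmetry [qbinom_sub].
    - The powers of [z]: [- (p * s + m) / p + (s - r) = - m / p - r].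
    - The powers of [q]: completing the square, the exponent on either side is
      [(m + p * r) ^ 2 / (2 * p)].

    If [s < 0], both sums are empty. *)

Lemma qpowD (a b : rat) : qpow (a + b) = qpow a * qpow b.
Proof. by rewrite /qpow vpowD monalg.mpolyCM tofracM. Qed.

Lemma zpowD (a b : rat) : zpow (a + b) = zpow a * zpow b.
Proof. exact: vpowD. Qed.

Lemma qbinom_sub (F : fieldType) (q : F) (n r : int) :
  qbinom q n (n - r) = qbinom q n r.
Proof.
rewrite /qbinom subr_ge0 gerBl andbC; case: ifP => // _.
by congr (_ / _); rewrite subKr mulrC.
Qed.

(** The support of the summand is only known through a bound, so the sum over
    all naturals is cut down to an ordinary one. *)
Lemma fsbig_nat_ord (V : nmodType) (n : nat) (f : nat -> V) :
  (forall r, (n <= r)%N -> f r = 0) ->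
  \sum_(r \in [set: nat]) f r = \sum_(r < n) f r.
Proof.
move=> f0; rewrite fsbig_ord; apply/esym/fsbig_widen => // r [_ /= /negP].
by rewrite -leqNgt => /f0.
Qed.

(** Prefactor and monomials merge into a single monomial in [z] and [q], so that
    terms can be compared through their exponents. *)
Lemma mul_monomial (a b c d : rat) (B : Fzq) :
  zpow a * qpow b * (qpow c * B * zpow d) = zpow (a + d) * qpow (b + c) * B.
Proof.
by rewrite zpowD qpowD [LHS](AC (2*(2*1)) ((1*5)*(2*3)*4)).
Qed.

Theorem corollary19 (p m k i m' k' : int)
    (hp : 0 < p)
    (hi : i = ((- m + k - 2) %% p)%Z)
    (hm' : m' = m - 2 * p + 1)
    (hk' : k' = k + p - 2) :
  zpow (- m%:~R / p%:~R) * qpow (m%:~R ^+ 2 / (2 * p%:~R)) *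
    (\sum_(r \in [set: nat])
       (qpow (p%:~R * r%:R ^+ 2 / 2 + m%:~R * r%:R)
        * qbinom (qpow 1) (k - m + p - 2 + (1 - p) * r%:Z) r%:Z
        * zpow (- r%:R)))
  = zpow ((- k' + i)%:~R / p%:~R)
    * qpow ((k' ^+ 2 + i ^+ 2 - 2 * k' * i)%:~R / (2 * p%:~R)) *
    (\sum_(r \in [set: nat])
       (qpow (p%:~R * r%:R ^+ 2 / 2 + (i - k')%:~R * r%:R)
        * qbinom (qpow 1)
            (((- m' + k' - i + 1) %/ p)%Z - 2 + i + (p - 1) * r%:Z)
            (i + p * r%:Z)
        * zpow r%:R)).
Proof.
have p_neq0 : p != 0 by rewrite gt_eqF.
have i_ge0 : 0 <= i by rewrite hi modz_ge0.
have i_ltp : i < p by rewrite hi ltz_pmod.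
have [s Ns] : exists s : int, k - m + p - 2 = p * s + i.
  (* [N] exceeds the dividend [- m + k - 2] by exactly [p] *)
  exists (((- m + k - 2) %/ p)%Z + 1).
  by have := divz_eq (- m + k - 2) p; rewrite -hi; lia.
have -> : ((- m' + k' - i + 1) %/ p)%Z - 2 = s.
  have -> : - m' + k' - i + 1 = (s + 2) * p by rewrite hm' hk'; lia.
  by rewrite mulzK // addrK.
have k'E : k' = p * s + m + i by lia.
have L0 (r : nat) : s < r%:Z ->
    qbinom (qpow 1) (k - m + p - 2 + (1 - p) * r%:Z) r%:Z = 0.
  move=> sr; apply: qbinom_eq0; nia.
have R0 (r : nat) : s < r%:Z ->
    qbinom (qpow 1) (s + i + (p - 1) * r%:Z) (i + p * r%:Z) = 0.
  move=> sr; apply: qbinom_eq0; lia.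
(* number of indices in [0 .. s], zero when [s < 0] *)
pose n : nat := if s is Posz t then t.+1 else 0%N.
have s_ltn (r : nat) : (n <= r)%N -> s < r%:Z by rewrite /n; case: (s); lia.
rewrite !(@fsbig_nat_ord _ n) => [|r /s_ltn sr|r /s_ltn sr]; last 2 first.
- by rewrite R0 // mulr0 mul0r.
- by rewrite L0 // mulr0 mul0r.
rewrite [in RHS](reindex_inj rev_ord_inj) !big_distrr /=.
apply: eq_bigr => r _.
have sr : (n - r.+1)%N%:Z = s - r%:Z.
  by case: r => r /=; rewrite /n; case: (s); lia.
rewrite !mul_monomial Ns.
have pQ : (p%:~R : rat) != 0 by rewrite intr_eq0.
have srQ : (n - r.+1)%N%:R = s%:~R - r%:R :> rat.
  by rewrite pmulrn sr rmorphB.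
rewrite sr srQ k'E; congr (zpow _ * qpow _ * _).
- by rewrite !(rmorphD, rmorphN, rmorphM) /=; field.
- by rewrite !(rmorphD, rmorphN, rmorphM, rmorphXn) /=; field.
(* symmetry, applied on the left, turns the lower entry [r] into [i + p * (s - r)] *)
by rewrite -qbinom_sub; congr qbinom; lia.
Qed.
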